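(* Let $\mathcal{H}$ be a complex separable Hilbert space. For any unitary operator $U$ on $\mathcal{H}$ we have $U^*\in\mathfrak{O}_c(U)$.
   Context: A conjugation on a complex Hilbert space is an antilinear, isometric map $C$ with $C^2=I$. For a unitary operator $U$ on $\mathcal{H}$, the conjugate orbit is $\mathfrak{O}_c(U)=\{CUC: C \text{ a conjugation on } \mathcal{H}\}$. *)

(* Defs.v *)
From HB Require Import structures.
From mathcomp Require Import all_boot all_order all_algebra.
From mathcomp Require Import complex.
From mathcomp Require Import all_classical all_reals all_analysis.

Set Implicit Arguments.
Unset Strict Implicit.
Unset Printing Implicit Defensive.

Import Order.TTheory GRing.Theory Num.Theory.
Import numFieldNormedType.Exports.

Local Open Scope classical_set_scope.
Local Open Scope ring_scope.
Local Open Scope complex_scope.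

(* [inner] is linear in its first and conjugate-linear in its second argument.
   Norms on a normed module over [R[i]] take their values in [R[i]] too, where
   [0 <= z] means that [z] is a nonnegative real. *)
HB.mixin Record CompleteNormedModule_isHilbert (R : realType) H
    of CompleteNormedModule R[i] H := {
  inner : {dot H for Num.conj};
  sqr_norm_inner : forall x : H, `|x| ^+ 2 = inner x x
}.

#[short(type="hilbertType")]
HB.structure Definition Hilbert (R : realType) :=
  {H of CompleteNormedModule_isHilbert R H & CompleteNormedModule R[i] H}.

Definition separable (T : topologicalType) :=
  exists2 D : set T, countable D & dense D.

(* The vector [z] is unique if it exists, and it exists by the Riesz
   representation theorem if [A] is linear and continuous: the default value
   [0] is never used for bounded operators. *)
Definition adjoint (R : realType) (H : hilbertType R) (A : H -> H) (y : H) : H :=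
  xget 0 [set z : H | forall x : H, inner (A x) y = inner x z].

Definition unitary (R : realType) (H : hilbertType R) (U : {linear H -> H}) :=
  [/\ continuous U, adjoint U \o U = id & U \o adjoint U = id].

Definition antilinear (R : realType) (H : hilbertType R) (C : H -> H) :=
  forall (a : R[i]) (x y : H), C (a *: x + y) = Num.conj a *: C x + C y.

Definition conjugation (R : realType) (H : hilbertType R) (C : H -> H) :=
  [/\ antilinear C, forall x : H, `|C x| = `|x| & C \o C = id].

Definition conjugate_orbit (R : realType) (H : hilbertType R) (U : H -> H) :
    set (H -> H) :=
  [set C \o U \o C | C in @conjugation R H].

(* Main.v *)
Require Import Defs.
From mathcomp Require Import all_boot all_order all_algebra.
From mathcomp Require Import complex ring.
From mathcomp Require Import all_classical all_reals all_analysis.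

Import Order.TTheory GRing.Theory Num.Theory.
Import numFieldNormedType.Exports.

Local Open Scope classical_set_scope.
Local Open Scope ring_scope.

(* Call a set G of pairs a partial conjugation when it is
   antilinear, norm-preserving, symmetric and stable under (x, y) |-> (U x, A y),
   where A is the adjoint of U. Symmetry encodes C^2 = I, and stability together
   with symmetry gives C U C = A, so a partial conjugation defined everywhere
   is the graph of the conjugation we want.
   A maximal one, given by Zorn's lemma, is closed, hence so is its domain by
   completeness. If the domain were not everything there would be some y <> 0
   orthogonal to it; the antilinear extension of U^n y |-> U^(-n) y to the
   U-cyclic subspace of y is isometric since
   <U^(-n) y, U^(-m) y> = <U^m y, U^n y>, and that subspace is orthogonal to
   the domain, so the orthogonal sum would be a proper extension. *)

(** * Inner products, norms and Cauchy sequences *)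

Lemma near_infty_natSinv_ltC {R : realType} (e : R[i]) : 0 < e ->
  \forall n \near \oo, n.+1%:R^-1 < e.
Proof.
move=> e0; have eR : e \is Num.real by rewrite gtr0_real.
have e0' : 0 < complex.Re e by rewrite -ltcR (RRe_real eR).
have := near_infty_natSinv_lt (PosNum e0'); apply: filterS => n /=.
by rewrite -ltcR (RRe_real eR) fmorphV rmorph_nat.
Qed.

(* [inner] elaborates to deeply nested canonical structures on which rewriting
   fails; [ip] fixes the codomain to be [R[i]]. *)
Definition ip {R : realType} {H : hilbertType R} (x y : H) : R[i] := inner x y.

Lemma ipDl {R : realType} {H : hilbertType R} (x y z : H) :
  ip (x + y) z = ip x z + ip y z.
Proof. exact: linearDl. Qed.

Lemma ipZl {R : realType} {H : hilbertType R} (a : R[i]) (x y : H) :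
  ip (a *: x) y = a * ip x y.
Proof. exact: linearZl_LR. Qed.

Lemma ipC {R : realType} {H : hilbertType R} (x y : H) :
  ip y x = Num.conj (ip x y).
Proof. by rewrite /ip hermC expr0 mul1r. Qed.

Lemma sqr_norm_ip {R : realType} {H : hilbertType R} (x : H) :
  `|x| ^+ 2 = ip x x :> R[i].
Proof. exact: sqr_norm_inner. Qed.

Lemma ipDr {R : realType} {H : hilbertType R} (x y z : H) :
  ip x (y + z) = ip x y + ip x z.
Proof. by rewrite ipC ipDl rmorphD /= -!ipC. Qed.

Lemma ipZr {R : realType} {H : hilbertType R} (a : R[i]) (x y : H) :
  ip x (a *: y) = Num.conj a * ip x y.
Proof. by rewrite ipC ipZl rmorphM /= -ipC. Qed.

Lemma ipNl {R : realType} {H : hilbertType R} (x y : H) : ip (- x) y = - ip x y.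
Proof. by rewrite -scaleN1r ipZl mulN1r. Qed.

Lemma ipNr {R : realType} {H : hilbertType R} (x y : H) : ip x (- y) = - ip x y.
Proof. by rewrite ipC ipNl rmorphN /= -ipC. Qed.

Lemma ip0l {R : realType} {H : hilbertType R} (x : H) : ip 0 x = 0.
Proof. by rewrite -(scale0r 0) ipZl mul0r. Qed.

Lemma ip0r {R : realType} {H : hilbertType R} (x : H) : ip x 0 = 0.
Proof. by rewrite ipC ip0l rmorph0. Qed.

Lemma ip_eq {R : realType} {H : hilbertType R} (y z : H) :
  (forall x, ip x y = ip x z) -> y = z.
Proof.
move=> yz; apply/eqP; rewrite -subr_eq0 -normr_eq0 -sqrf_eq0 sqr_norm_ip.
by rewrite ipDr ipNr yz subrr.
Qed.

Lemma norm_eq_ip {R : realType} {H : hilbertType R} (x y : H) :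
  ip x x = ip y y -> `|x| = `|y|.
Proof.
by rewrite -!sqr_norm_ip => /eqP; rewrite eqrXn2 // => /eqP.
Qed.

Lemma parallelogram_id {R : realType} {H : hilbertType R} (x y : H) :
  `|x + y| ^+ 2 + `|x - y| ^+ 2 = 2 * (`|x| ^+ 2 + `|y| ^+ 2) :> R[i].
Proof. by rewrite !sqr_norm_ip !(ipDl, ipDr, ipNl, ipNr); ring. Qed.

Lemma cauchy_seq_normP {R : realType} {H : hilbertType R} (u : nat -> H) :
  (forall e : R[i], 0 < e ->
     \forall p \near (\oo, \oo)%classic, `|u p.1 - u p.2| < e) <->
  cauchy (u @ \oo).
Proof.
split.
  move=> h; apply/cauchy_ballP => e e0.
  have [[P Q]/= [hP hQ] PQ] := h e e0.
  exists (u @` P, u @` Q); last first.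
    case=> _ _ [[a Pa <-] [b Qb <-]]; rewrite -ball_normE /=.
    exact: (PQ (a, b)).
  by split; [move: hP|move: hQ]; apply: filterS => k ?; exists k.
move=> /cauchy_ballP h e e0; have [[P Q]/= [hP hQ] PQ] := h e e0.
exists (u @^-1` P, u @^-1` Q) => // -[a b] [/= Pa Qb].
by have := PQ (u a, u b) (conj Pa Qb); rewrite -ball_normE.
Qed.

(** * Nearest points and orthogonal vectors *)

Lemma exists_inf_sqr_dist {R : realType} {H : hilbertType R} (V : set H) (x : H) :
  V !=set0 -> exists d : R[i],
  [/\ d \is Num.real, forall w, V w -> d <= `|x - w| ^+ 2
    & forall e, 0 < e -> exists2 w, V w & `|x - w| ^+ 2 < d + e].
Proof.
move=> [v Vv].
(* The order on [R[i]] is partial, so the infimum is taken in [R] over real parts and embedded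
   back. *)
have rE w : (complex.Re (`|x - w| ^+ 2))%:C%C = `|x - w| ^+ 2.
  by rewrite RRe_real // rpredX.
pose S := [set complex.Re (`|x - w| ^+ 2) | w in V].
have S0 : has_lbound S.
  by exists 0 => _ [w _ <-]; rewrite -lecR rE exprn_ge0.
exists (inf S)%:C%C; split.
- by apply/complex_realP; exists (inf S).
- by move=> w Vw; rewrite -rE lecR ge_inf //; exists w.
- move=> e e0; have eR : e \is Num.real by rewrite gtr0_real.
  have e0' : 0 < complex.Re e by rewrite -ltcR (RRe_real eR).
  have [|_ [w Vw <-]] := @inf_adherent _ S _ e0'.
    by split=> //; exists (complex.Re (`|x - v| ^+ 2)); exists v.
  by rewrite -ltcR rE rmorphD /= RRe_real // => ?; exists w.
Qed.

(** Subtracting from [x] its projection on [w] lowers the squared norm by [|ip x w|^2 / ip w w], so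
    minimality forces this to vanish. *)
Lemma min_dist_orthogonal {R : realType} {H : hilbertType R} (x w : H) :
  (forall a : R[i], `|x| ^+ 2 <= `|x - a *: w| ^+ 2) -> ip x w = 0.
Proof.
move=> h; have [->|w0] := eqVneq w 0; first exact: ip0r.
have ww0 : 0 < ip w w by rewrite -sqr_norm_ip exprn_gt0 // normr_gt0.
have := h (ip x w / ip w w).
rewrite !sqr_norm_ip !(ipDl, ipDr, ipNl, ipNr, ipZl, ipZr) (ipC x w).
rewrite rmorphM /= fmorphV /= -(ipC w w).
set c := ip x w; set d := ip w w.
suff -> : ip x x - Num.conj c / d * c + (- (c / d * Num.conj c)
    - - (c / d * (Num.conj c / d * d))) = ip x x - (c * Num.conj c) / d.
  rewrite -normCK lerDl oppr_ge0 pmulr_lle0 ?invr_gt0 // => h1.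
  by apply/eqP; rewrite -normr_eq0 -sqrf_eq0 eq_le h1 exprn_ge0.
by field; rewrite gt_eqF.
Qed.

Lemma cvg_sqr_norm_lt {K : numFieldType} {V : normedModType K} (u : nat -> V)
    (l : V) (e : K) : 0 < e -> u @ \oo --> l ->
  \forall n \near \oo, `| `|l| ^+ 2 - `|u n| ^+ 2 | < e.
Proof.
move=> e0 /cvg_norm ul;
have : `|u n| * `|u n| @[n --> \oo] --> (`|l| * `|l| : K^o).
  by exact: (cvgM ul ul).
by move/(@cvgrPdist_lt _ K^o)/(_ e e0); apply: filterS => n /=; rewrite !expr2.
Qed.

Lemma cvg_norm_sqr_le {R : realType} {H : hilbertType R} (u : nat -> H) (l : H)
    (d : R[i]) : d \is Num.real ->
  (forall n, `|u n| ^+ 2 <= d + n.+1%:R^-1) -> u @ \oo --> l -> `|l| ^+ 2 <= d.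
Proof.
move=> dR ud ul; rewrite real_leNgt ?rpredX ?normr_real //; apply/negP => dl.
pose e := `|l| ^+ 2 - d; have e0 : 0 < e by rewrite subr_gt0.
have e2 : 0 < e / 2 by rewrite divr_gt0.
near \oo => n.
have h2 : `| `|l| ^+ 2 - `|u n| ^+ 2 | < e / 2.
  by near: n; exact: cvg_sqr_norm_lt.
have h3 : n.+1%:R^-1 < e / 2 by near: n; exact: near_infty_natSinv_ltC.
have h4 : `|l| ^+ 2 - `|u n| ^+ 2 < e / 2.
  apply: le_lt_trans h2.
  by rewrite real_ler_norm // ?rpredB ?rpredX ?normr_real.
have h5 : `|u n| ^+ 2 < d + e / 2 by rewrite (le_lt_trans (ud n)) // ltrD2l.
have := ltrD h4 h5; rewrite subrK addrCA -splitr /e addrCA subrr addr0.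
by rewrite ltxx.
Unshelve. all: by end_near. Qed.

(** The vector is [x - l], where [l] is the point of [V] nearest to [x], obtained as the limit of a
    minimizing sequence. *)
Lemma exists_orthogonal {R : realType} {H : hilbertType R} (V : set H) (x : H) :
  V 0 -> (forall (a : R[i]) v w, V v -> V w -> V (a *: v + w)) ->
  (forall (u : nat -> H) l, (forall n, V (u n)) -> u @ \oo --> l -> V l) ->
  ~ V x -> exists2 y, y <> 0 & forall w, V w -> ip y w = 0.
Proof.
move=> V0 Vlin Vcl Vx.
have [|d [dR dmin dinf]] := exists_inf_sqr_dist V x; first by exists 0.
have /choice [v hv] :
    forall n, exists w, V w /\ `|x - w| ^+ 2 < d + n.+1%:R^-1.
  move=> n; have [|w ? ?] := dinf n.+1%:R^-1; last by exists w.
  by rewrite invr_gt0 ltr0n.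
(* Parallelogram law: the midpoint of [v n] and [v m] lies in [V], so its squared distance to [x] is
   at least [d]. *)
have near_min n m : `|v n - v m| ^+ 2 <= 2 * (n.+1%:R^-1 + m.+1%:R^-1).
  have := parallelogram_id (x - v m) (x - v n).
  have -> : x - v m - (x - v n) = v n - v m by rewrite opprB addrC addrA subrK.
  have -> : x - v m + (x - v n) = 2 *: (x - 2^-1 *: (v m + v n)).
    rewrite scalerBr scalerA divff ?pnatr_eq0 // scale1r scaler_nat mulr2n.
    by rewrite addrACA opprD.
  have dm : 4 * d <= 4 * `|x - 2^-1 *: (v m + v n)| ^+ 2.
    rewrite ler_pM2l // dmin // scalerDr; apply: (Vlin); first by case: (hv m).
    by have := Vlin 2^-1 _ _ (proj1 (hv n)) V0; rewrite addr0.
  have dn : 2 * (`|x - v m| ^+ 2 + `|x - v n| ^+ 2)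
      <= 2 * ((d + m.+1%:R^-1) + (d + n.+1%:R^-1)).
    by rewrite ler_pM2l // lerD //; apply: ltW; [case: (hv m)|case: (hv n)].
  rewrite normrZ exprMn normr_nat -natrX => /eqP.
  rewrite addrC eq_sym -subr_eq => /eqP <-; apply: (le_trans (lerB dn dm)).
  by rewrite le_eqVlt; apply/orP; left; apply/eqP; ring.
have : cauchy (v @ \oo).
  apply/cauchy_seq_normP => e e0.
  have e4 : 0 < e ^+ 2 / 4 by rewrite divr_gt0 // exprn_gt0.
  pose A := [set n | n.+1%:R^-1 < e ^+ 2 / 4].
  have nA : nbhs \oo A := near_infty_natSinv_ltC _ e4.
  exists (A, A) => // -[n m] [/= An Am].
  rewrite -(@ltr_pXn2r _ 2) ?nnegrE // ?ltW //.
  apply: (le_lt_trans (near_min _ _)).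
  have -> : e ^+ 2 = 2 * (e ^+ 2 / 4 + e ^+ 2 / 4) by field.
  by rewrite ltr_pM2l // ltrD.
move=> /cauchy_cvg /cvg_ex [l vl].
have Vl : V l by apply: Vcl vl => n; case: (hv n).
exists (x - l).
  by move=> /eqP; rewrite subr_eq0 => /eqP xl; apply: Vx; rewrite xl.
move=> w Vw; apply: min_dist_orthogonal => a.
(* [d] separates the two sides: [l + a *: w] lies in [V], and [x - l] is the limit of the
   [x - v n]. *)
apply: (@le_trans _ _ d); last first.
  by rewrite -addrA -opprD [l + _]addrC dmin //; exact: Vlin.
apply: (@cvg_norm_sqr_le _ _ (fun n => x - v n)) => //.
  by move=> n; case: (hv n) => _ /ltW.
by apply: cvgB => //; exact: cvg_cst.
Qed.

(** * Isometries and unitary pairs *)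

Lemma cvg_eq_norm {K : numFieldType} {V : normedModType K} (u v : nat -> V)
    (l m : V) : u @ \oo --> l -> v @ \oo --> m ->
  (forall n, `|v n| = `|u n|) -> `|m| = `|l|.
Proof.
move=> /cvg_norm ul /cvg_norm vm uv.
have {}vm : `|u n| @[n --> \oo] --> `|m| by under eq_fun do rewrite -uv.
exact: (cvg_unique (@norm_hausdorff K K^o) vm ul).
Qed.

Lemma cvg_isometry {K : numFieldType} {V : normedModType K} (f : V -> V)
    (u : nat -> V) (l : V) : (forall x y, `|f x - f y| = `|x - y|) ->
  u @ \oo --> l -> f \o u @ \oo --> f l.
Proof.
move=> fE /cvgrPdist_lt ul; apply/cvgrPdist_lt => e e0.
by move: (ul e e0); apply: filterS => n /=; rewrite fE.
Qed.

(** Symmetric in [U] and [A], so each fact proved for [U] transfers to [A]; linearity and isometry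
    follow from adjointness and inversion. *)
Definition unitary_pair {R : realType} {H : hilbertType R} (U A : H -> H) :=
  [/\ cancel U A, cancel A U & forall x y, ip (U x) y = ip x (A y)].

Lemma unitary_pair_sym {R : realType} {H : hilbertType R} {U A : H -> H} :
  unitary_pair U A -> unitary_pair A U.
Proof.
by move=> [UK AK adj]; split=> // x y; rewrite ipC -adj -ipC.
Qed.

Lemma unitary_pair_linear {R : realType} {H : hilbertType R} {U A : H -> H}
    (UA : unitary_pair U A) (a : R[i]) (x y : H) :
  U (a *: x + y) = a *: U x + U y.
Proof.
have [_ _ adj] := unitary_pair_sym UA; apply: ip_eq => z.
by rewrite -adj !ipDr !ipZr !adj.
Qed.

Lemma unitary_pair_dist {R : realType} {H : hilbertType R} {U A : H -> H}
    (UA : unitary_pair U A) (x y : H) : `|U x - U y| = `|x - y|.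
Proof.
have [UK AK adj] := UA; apply: norm_eq_ip.
have -> : U x - U y = U (x - y).
  by rewrite addrC -scaleN1r -(unitary_pair_linear UA) scaleN1r addrC.
by rewrite adj UK.
Qed.

Lemma unitary_pair_adjoint {R : realType} {H : hilbertType R}
    (U : {linear H -> H}) : unitary U -> unitary_pair U (adjoint U).
Proof.
move=> [_ UK AK]; split=> [x|x|x y].
- exact: (congr1 (fun f => f x) UK).
- exact: (congr1 (fun f => f x) AK).
have {}AK z : U (adjoint U z) = z by exact: (congr1 (fun f => f z) AK).
(* The default value of [adjoint] only occurs at [y = 0], since [U] maps it
   to [y]. *)
move: (AK y); rewrite /adjoint; case: xgetP => [z _ zP _|_].
  exact: zP.
by rewrite linear0 => <-; rewrite !ip0r.
Qed.

(** * Partial conjugations and their closures *)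

Record partial_conj {R : realType} {H : hilbertType R} (U A : H -> H)
    (G : set (H * H)) : Prop := PartialConj {
  pc_lin : forall (a : R[i]) x y x' y', G (x, y) -> G (x', y') ->
    G (a *: x + x', Num.conj a *: y + y');
  pc_norm : forall x y, G (x, y) -> `|y| = `|x|;
  pc_sym : forall x y, G (x, y) -> G (y, x);
  pc_step : forall x y, G (x, y) -> G (U x, A y)
}.

Arguments pc_lin {R H U A G} _ a {x y x' y'}.
Arguments pc_norm {R H U A G} _ {x y}.
Arguments pc_sym {R H U A G} _ {x y}.
Arguments pc_step {R H U A G} _ {x y}.

Lemma pcB {R : realType} {H : hilbertType R} {U A : H -> H}
    {G : set (H * H)} {x y x' y' : H} : partial_conj U A G ->
  G (x, y) -> G (x', y') -> G (x - x', y - y').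
Proof.
move=> pG g g'; have := pc_lin pG (-1) g' g.
by rewrite rmorphN1 !scaleN1r ![- _ + _]addrC.
Qed.

Lemma pc_dist {R : realType} {H : hilbertType R} {U A : H -> H}
    {G : set (H * H)} {x y x' y' : H} : partial_conj U A G ->
  G (x, y) -> G (x', y') -> `|y - y'| = `|x - x'|.
Proof. by move=> pG g g'; apply: (pc_norm pG); exact: (pcB pG). Qed.

(** Single-valuedness comes from linearity and norm preservation, so graphs can be united and closed
    freely. *)
Lemma pc_uniq {R : realType} {H : hilbertType R} {U A : H -> H}
    {G : set (H * H)} {x y z : H} : partial_conj U A G ->
  G (x, y) -> G (x, z) -> y = z.
Proof.
move=> pG g g'; apply/eqP.
by rewrite -subr_eq0 -normr_eq0 (pc_dist pG g g') subrr normr0.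
Qed.

Definition seq_closure {R : realType} {H : hilbertType R} (G : set (H * H)) :
    set (H * H) :=
  [set p | exists u v : nat -> H, [/\ forall n, G (u n, v n),
    u @ \oo --> p.1 & v @ \oo --> p.2]].

Lemma seq_closure_pc {R : realType} {H : hilbertType R} (U A : H -> H)
    (G : set (H * H)) : unitary_pair U A ->
  partial_conj U A G -> partial_conj U A (seq_closure G).
Proof.
move=> UA pG; split.
- move=> a x y x' y' [u [v [g /= ux vy]]] [u' [v' [g' /= ux' vy']]].
  exists (fun n => a *: u n + u' n), (fun n => Num.conj a *: v n + v' n).
  split=> [n||]; first exact: (pc_lin pG).
    by apply: cvgD => //; exact: cvgZr.
  by apply: cvgD => //; exact: cvgZr.
- move=> x y [u [v [g /= ux vy]]].
  by apply: cvg_eq_norm ux vy _ => n; exact: (pc_norm pG).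
- move=> x y [u [v [g /= ux vy]]]; exists v, u.
  by split=> // n; exact: (pc_sym pG).
- move=> x y [u [v [g /= ux vy]]]; exists (U \o u), (A \o v).
  split=> [n||]; first exact: (pc_step pG).
    by apply: cvg_isometry ux => a b; exact: (unitary_pair_dist UA).
  apply: cvg_isometry vy => a b.
  exact: (unitary_pair_dist (unitary_pair_sym UA)).
Qed.

(** Distances are preserved, so the images of a convergent sequence are Cauchy; the limit pair lies
    in the closed graph. *)
Lemma domain_seq_closed {R : realType} {H : hilbertType R} (U A : H -> H)
    (G : set (H * H)) (u : nat -> H) (l : H) : partial_conj U A G ->
  seq_closure G `<=` G -> (forall n, exists y, G (u n, y)) ->
  u @ \oo --> l -> exists y, G (l, y).
Proof.
move=> pG Gcl /choice[v g] ul.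
have cu : cauchy (u @ \oo) by apply: cvg_cauchy; apply/cvg_ex; exists l.
have /cauchy_cvg /cvg_ex[m vm] : cauchy (v @ \oo).
  apply/cauchy_seq_normP => e e0; move/cauchy_seq_normP: cu => /(_ e e0).
  by apply: filterS => -[n k] /=; rewrite (pc_dist pG (g n) (g k)).
by exists m; apply: Gcl; exists u, v.
Qed.

(** * Extension along a cyclic subspace *)

(** For a unitary pair, the antilinear extension of [U^n x |-> U^(-n) x], [n] any integer, to the
    algebraic span of the orbit. As a relation it needs no prior proof of being well defined. *)
Inductive cyclic_graph {R : realType} {H : hilbertType R} (U A : H -> H)
    (x : H) : H -> H -> Prop :=
| cyc_gen : cyclic_graph U A x x x
| cyc_lin (a : R[i]) p q p' q' :
    cyclic_graph U A x p q -> cyclic_graph U A x p' q' ->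
    cyclic_graph U A x (a *: p + p') (Num.conj a *: q + q')
| cyc_step p q : cyclic_graph U A x p q -> cyclic_graph U A x (U p) (A q)
| cyc_back p q : cyclic_graph U A x p q -> cyclic_graph U A x (A p) (U q).

Lemma cyc_sym {R : realType} {H : hilbertType R} {U A : H -> H} {x p q : H} :
  cyclic_graph U A x p q -> cyclic_graph U A x q p.
Proof.
elim=> {p q} [|a p q p' q' _ h _ h'|p q _|p q _].
- exact: cyc_gen.
- by rewrite -[X in X *: p](conjCK a); exact: cyc_lin.
- exact: cyc_back.
- exact: cyc_step.
Qed.

Lemma iter_unitary_pair {R : realType} {H : hilbertType R} {U A : H -> H}
    (UA : unitary_pair U A) n (x y : H) :
  ip (iter n U x) y = ip x (iter n A y).
Proof.
have [_ _ adj] := UA; elim: n x y => // n IHn x y.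
by rewrite iterS adj IHn -iterSr.
Qed.

(** The case of [cyc_ip] with one pair on the orbit of [x]; the two halves cover both signs of the
    exponent, which each step shifts by one. *)
Lemma cyc_ip_gen {R : realType} {H : hilbertType R} {U A : H -> H}
    {x p q : H} n : unitary_pair U A -> cyclic_graph U A x p q ->
  ip (iter n U x) q = ip p (iter n A x) /\
  ip (iter n A x) q = ip p (iter n U x).
Proof.
move=> UA; have AU := unitary_pair_sym UA.
have [UK AK adjU] := UA; have [_ _ adjA] := AU.
move=> pq; elim: pq n => {p q} [|a p q p' q' _ h _ h'|p q _ h|p q _ h] n.
- by rewrite !(iter_unitary_pair UA) !(iter_unitary_pair AU).
- have [h1 h2] := h n; have [h1' h2'] := h' n.
  by rewrite !ipDr !ipZr !ipDl !ipZl conjCK h1 h2 h1' h2'.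
- split; first by rewrite -adjU -iterS (h n.+1).1 adjU.
  (* At [n = 0] the exponent changes sign, which calls for the other half at index 1. *)
  case: n => [|n]; first by rewrite -adjU [LHS](h 1).1 adjU.
  by rewrite -adjU iterS AK (h n).2 iterS adjU UK.
- split; last by rewrite -adjA -iterS (h n.+1).2 adjA.
  case: n => [|n]; first by rewrite -adjA [LHS](h 1).2 adjA.
  by rewrite -adjA iterS UK (h n).1 iterS adjA AK.
Qed.

(** Adjointness turns a step on the first pair into the opposite step on the second, hence the
    induction with the second pair varying. *)
Lemma cyc_ip {R : realType} {H : hilbertType R} {U A : H -> H}
    {x p q p' q' : H} : unitary_pair U A ->
  cyclic_graph U A x p q -> cyclic_graph U A x p' q' -> ip q q' = ip p' p.
Proof.
move=> UA; have [_ _ adjU] := UA; have [_ _ adjA] := unitary_pair_sym UA.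
move=> pq.
elim: pq p' q' => {p q} [|a p q r s _ h _ h'|p q _ h|p q _ h] p' q' pq'.
- exact: (cyc_ip_gen 0 UA pq').1.
- by rewrite ipDl ipZl ipDr ipZr (h _ _ pq') (h' _ _ pq').
- by rewrite adjA (h _ _ (cyc_back _ _ _ _ _ pq')) adjA.
- by rewrite adjU (h _ _ (cyc_step _ _ _ _ _ pq')) adjU.
Qed.

(** The domain of [G] is invariant under [U] and [A], hence so is its orthogonal complement, which
    contains [x]. *)
Lemma cyc_orthogonal {R : realType} {H : hilbertType R} {U A : H -> H}
    {G : set (H * H)} {x p q v w : H} : unitary_pair U A ->
  partial_conj U A G -> (forall z, (exists y, G (z, y)) -> ip x z = 0) ->
  cyclic_graph U A x p q -> G (v, w) -> ip v p = 0.
Proof.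
move=> UA pG xG; have [_ _ adjU] := UA.
have [_ _ adjA] := unitary_pair_sym UA.
move=> pq; elim: pq v w => {p q} [|a p q r s _ h _ h'|p q _ h|p q _ h] v w vw.
- by rewrite ipC xG ?rmorph0 //; exists w.
- by rewrite ipDr ipZr (h _ _ vw) (h' _ _ vw) mulr0 addr0.
(* Conjugating [pc_step] by the symmetry gives stability under [(v, w) |-> (A v, U w)]. *)
- rewrite -adjA (h _ (U w)) //; apply: (pc_sym pG); apply: (pc_step pG).
  exact: (pc_sym pG).
- by rewrite -adjU (h _ (A w)) //; exact: (pc_step pG).
Qed.

(** Norms agree by Pythagoras: both graphs are symmetric, so second components are orthogonal as
    well as first ones. *)
Lemma sum_graph_pc {R : realType} {H : hilbertType R} (U A : H -> H)
    (G : set (H * H)) (x : H) : unitary_pair U A -> partial_conj U A G ->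
  (forall z, (exists y, G (z, y)) -> ip x z = 0) ->
  partial_conj U A [set t | exists v w p q,
    [/\ G (v, w), cyclic_graph U A x p q & t = (v + p, w + q)]].
Proof.
move=> UA pG xG; split.
- move=> a ? ? ? ? [v [w [p [q [vw pq [-> ->]]]]]].
  move=> [v' [w' [p' [q' [vw' pq' [-> ->]]]]]].
  exists (a *: v + v'), (Num.conj a *: w + w').
  exists (a *: p + p'), (Num.conj a *: q + q').
  split; [exact: (pc_lin pG)|exact: cyc_lin|].
  by rewrite !scalerDr; congr pair; rewrite addrACA.
- move=> ? ? [v [w [p [q [vw pq [-> ->]]]]]]; apply: norm_eq_ip.
  have vp := cyc_orthogonal UA pG xG pq vw.
  have wq := cyc_orthogonal UA pG xG (cyc_sym pq) (pc_sym pG vw).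
  rewrite !ipDl !ipDr vp wq (ipC v p) (ipC w q) vp wq rmorph0.
  by rewrite (cyc_ip UA pq pq) -!sqr_norm_ip (pc_norm pG vw).
- move=> ? ? [v [w [p [q [vw pq [-> ->]]]]]]; exists w, v, q, p.
  by split=> //; [exact: (pc_sym pG)|exact: cyc_sym].
- move=> ? ? [v [w [p [q [vw pq [-> ->]]]]]]; exists (U v), (A w), (U p), (A q).
  split; [exact: (pc_step pG)|exact: cyc_step|].
  have lU y z : U (y + z) = U y + U z.
    by rewrite -[y]scale1r (unitary_pair_linear UA) !scale1r.
  have lA y z : A (y + z) = A y + A z.
    rewrite -[y]scale1r (unitary_pair_linear (unitary_pair_sym UA)).
    by rewrite !scale1r.
  by rewrite lU lA.
Qed.

(** * Maximality and conclusion *)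

Lemma exists_total_pc {R : realType} {H : hilbertType R} (U A : H -> H) :
  unitary_pair U A ->
  exists2 G, partial_conj U A G & forall x, exists y, G (x, y).
Proof.
move=> UA; have [UK AK adjU] := UA.
have [|G [pG Gmax]] := @Zorn_bigcup _ (partial_conj U A).
  move=> F Fpc Ftot; split.
  - move=> a x y x' y' [G FG g] [G' FG' g'].
    have [GG'|GG'] := Ftot _ _ FG FG'.
      by exists G' => //; apply: (pc_lin (Fpc _ FG')) => //; exact: GG'.
    by exists G => //; apply: (pc_lin (Fpc _ FG)) => //; exact: GG'.
  - by move=> x y [G FG g]; exact: (pc_norm (Fpc _ FG)).
  - by move=> x y [G FG g]; exists G => //; exact: (pc_sym (Fpc _ FG)).
  - by move=> x y [G FG g]; exists G => //; exact: (pc_step (Fpc _ FG)).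
have {}Gmax G' : partial_conj U A G' -> G `<=` G' -> G' `<=` G.
  move=> pG' GG'; apply: contrapT => nG'.
  by apply: (Gmax G') pG'; split.
have U0 : U 0 = 0.
  have := unitary_pair_linear UA (-1) 0 0.
  by rewrite !scaleN1r oppr0 add0r addNr.
have A0 : A 0 = 0 by rewrite -{1}U0 UK.
have G00 : G (0, 0).
  (* The empty graph is also a partial conjugation; maximality against the zero graph excludes
     it. *)
  have [[[y z] g]|G0] := pselect (G !=set0).
    by have := pcB pG g g; rewrite !subrr.
  apply: (Gmax [set (0, 0)]) => //; last first.
    by move=> t gt; case: G0; exists t.
  split.
  - by move=> a x y x' y' [-> ->] [-> ->]; rewrite /= !scaler0 !addr0.
  - by move=> x y [-> ->].
  - by move=> x y [-> ->].
  - by move=> x y [-> ->]; rewrite /= U0 A0.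
exists G => // x; apply: contrapT => Gx.
have Gcl : seq_closure G `<=` G.
  apply: Gmax; first exact: seq_closure_pc.
  move=> [y z] g; exists (fun=> y), (fun=> z).
  by split=> //; exact: cvg_cst.
have [| | |y y0 yG] :=
  exists_orthogonal [set z | exists w, G (z, w)] x _ _ _ Gx.
- by exists 0.
- move=> a v w [v' vv'] [w' ww']; exists (Num.conj a *: v' + w').
  exact: (pc_lin pG).
- by move=> u l Gu ul; exact: (domain_seq_closed _ _ _ _ _ pG Gcl Gu ul).
(* By maximality the orthogonal sum lies in [G], so [y] is in the domain and orthogonal to
   itself. *)
have gyy : G (y, y).
  apply: (Gmax _ (sum_graph_pc _ _ _ _ UA pG yG)).
    move=> [v w] g; exists v, w, 0, 0; split=> //; last by rewrite !addr0.
    (* The pair [(0, 0)] is obtained as [-y + y] in both components. *)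
    have := cyc_lin U A y (-1) _ _ _ _ (cyc_gen U A y) (cyc_gen U A y).
    by rewrite rmorphN1 !scaleN1r addNr.
  exists 0, 0, y, y; split=> //; last by rewrite !add0r.
  exact: cyc_gen.
apply: y0; have yy : ip y y = 0 by apply: yG; exists y.
by apply/eqP; rewrite -normr_eq0 -sqrf_eq0 sqr_norm_ip yy.
Qed.

Theorem proposition2p1 (R : realType) (H : hilbertType R)
  (Hsep : separable H) (U : {linear H -> H}) (hU : unitary U) :
  conjugate_orbit U (adjoint U).
Proof.
have UA := unitary_pair_adjoint U hU.
have [G pG /choice[C GC]] := exists_total_pc _ _ UA.
have CK x : C (C x) = x by apply: (pc_uniq pG (GC _)); exact: (pc_sym pG).
exists C; last first.
  (* Stability applied to [(C x, x)] puts [(U (C x), adjoint U x)] in [G]. *)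
  apply/funext => x /=; apply: (pc_uniq pG (GC _)).
  by apply: (pc_step pG); exact: (pc_sym pG).
split.
- by move=> a x y; apply: (pc_uniq pG (GC _)); exact: (pc_lin pG).
- by move=> x; exact: (pc_norm pG).
- by apply/funext => x /=.
Qed.
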